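(* Let $X_n$ be the number of correct guesses under the optimal strategy in the complete feedback game after one symmetric (i.e. $p=\frac12$) single-shelf shuffle of $n$ cards. Then \[ \mathbb{E}[X_n]=\begin{cases}1, & n=1,\\ \frac{3n}{4}, & n\ge2,\end{cases} \qquad \mathrm{Var}(X_n)=\begin{cases}0, & n=1,\\ \frac14, & n=2,\\ \frac{n}{16}, & n\ge3.\end{cases} \]
   Context: Symmetric single-shelf shuffle: start with an ordered deck of $n$ cards labelled $1,\dots,n$ (card $1$ on top). Cards are drawn one at a time from the bottom of the deck (card $n$ first, card $1$ last) and placed in a pile; independently, each drawn card is placed at the top or at the bottom of the pile with probability $\frac12$ each. Equivalently, let $\varepsilon_1,\dots,\varepsilon_{n-1}$ be independent Bernoulli$(\frac12)$; the shuffled deck read from the top consists of the cards $j\le n-1$ with $\varepsilon_j=1$ in increasing order, then card $n$, then the cards with $\varepsilon_j=0$ in decreasing order. Complete feedback game: the player guesses the cards of the shuffled deck sequentially from the top; after each guess the card is shown and removed. Optimal strategy used: guess $1$ first, then always guess the successor $j+1$ of the last shown card $j$ until card $n$ or $n-1$ has been shown; afterwards guess the remaining cards in decreasing order. $X_n$ is the number of correct guesses under this strategy. *)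

(* Defs.v *)
From HB Require Import structures.
From mathcomp Require Import all_boot all_order all_algebra.
From mathcomp Require Import all_classical all_reals all_analysis.

Set Implicit Arguments.
Unset Strict Implicit.
Unset Printing Implicit Defensive.

Import Order.TTheory GRing.Theory Num.Theory.

Local Open Scope classical_set_scope.

(* Mutual independence: the product rule holds for every finite subfamily and
   every choice of measurable events. *)
Definition mutually_independent d d' (T : measurableType d)
    (T' : measurableType d') (R : realType) (P : probability T R)
    (I : finType) (X : I -> {RV P >-> T'}) : Prop :=
  forall (J : {set I}) (A : I -> set T'),
    (forall i, i \in J -> measurable (A i)) ->
    P (\bigcap_(i in [set` J]) (X i @^-1` A i)) =
      (\prod_(i in J) P (X i @^-1` A i))%E.

Section SingleShelfShuffle.
Local Open Scope nat_scope.

(* A deck or pile is the list of its labels read from the top; the card with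
   label [i.+1] is indexed by [i : 'I_n], and [e i = true] means that this card
   is placed at the top of the pile.  The cards are drawn from the bottom of the
   deck, i.e. in the order n, n-1, ..., 1. *)
Definition place_card n (e : 'I_n -> bool) (pile : seq nat) (i : 'I_n) :
    seq nat :=
  if e i then i.+1 :: pile else rcons pile i.+1.

Definition shelf_shuffle n (e : 'I_n -> bool) : seq nat :=
  foldl (place_card e) [::] (rev (enum 'I_n)).

(* Explicit form: the coin of card n, which is drawn onto the empty pile, plays
   no role, since card n comes last in the first block or first in the second. *)
Lemma shelf_shuffleE n (e : 'I_n -> bool) :
  shelf_shuffle e = [seq (val i).+1 | i <- enum 'I_n & e i] ++
                    rev [seq (val i).+1 | i <- enum 'I_n & ~~ e i].
Proof.
rewrite /shelf_shuffle foldl_rev; elim: (enum 'I_n) => //= i l ->.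
rewrite /place_card; case: (e i) => //=.
by rewrite rev_cons rcons_cat.
Qed.

End SingleShelfShuffle.

Section CompleteFeedbackGame.
Local Open Scope nat_scope.

(* A strategy maps the list of cards shown so far (oldest first) to the next
   guess. *)
Fixpoint correct_guesses_from (strategy : seq nat -> nat)
    (shown deck : seq nat) : nat :=
  if deck is c :: deck' then
    (strategy shown == c) +
      correct_guesses_from strategy (rcons shown c) deck'
  else 0.

Definition correct_guesses (strategy : seq nat -> nat) (deck : seq nat) : nat :=
  correct_guesses_from strategy [::] deck.

(* Before any card is shown, [last 0 shown] is 0, so that the first guess is 1.
   For n = 1, [n.-1 = 0] is not a label.  Once card n or n-1 has been shown, the
   guess is the largest remaining card. *)
Definition optimal_strategy (n : nat) (shown : seq nat) : nat :=
  if (n \in shown) || (n.-1 \in shown)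
  then \max_(c <- iota 1 n | c \notin shown) c
  else (last 0 shown).+1.

End CompleteFeedbackGame.

(* The random variable X_n, real-valued; [eps i w] is the coin of card [i.+1]. *)
Definition num_correct (R : realType) (T : Type) (n : nat)
    (eps : 'I_n -> T -> bool) (w : T) : R :=
  (correct_guesses (optimal_strategy n)
     (shelf_shuffle (fun i => eps i w)))%:R%R.

(* Main.v *)
Require Import Defs.
From HB Require Import structures.
From mathcomp Require Import all_boot all_order all_algebra.
From mathcomp Require Import all_classical all_reals all_analysis.
From mathcomp Require Import ring lra zify.

Set Implicit Arguments.
Unset Strict Implicit.
Unset Printing Implicit Defensive.

Import Order.TTheory GRing.Theory Num.Theory.

Local Open Scope ring_scope.

(** With n = m.+1 cards, let s_c = -1 if the coin of card c puts it on top of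
the pile and s_c = 1 otherwise, for 1 <= c <= m, and put s_0 = s_n = -1.  The
deck consists of the rising cards (s_c = -1), then n, then the falling cards.
Once n-1 or n has been seen, every remaining guess is correct; before that, a
rising card c is guessed correctly exactly when c-1 also rises (card 0 standing
for the empty table).  Hence ([correct_guesses_shuffle]) each c in 1..n
contributes 1, unless it rises while c-1 falls, where n always rises.  In terms
of the spins this contribution is
<<
   1 - (1 - s_c)(1 + s_{c-1})/4 = 3/4 + (s_c - s_{c-1})/4 + s_{c-1} s_c/4,
>>
and as s_0 = s_n the linear terms telescope away ([correct_guesses_edges]):
<<
   X_n = 3n/4 + (s_0 s_1 + s_1 s_2 + ... + s_{n-1} s_n)/4.
>>
Up to sign, the n products on the right are Walsh characters of the fair coins.
For n >= 2 none of them is constant, so they have mean 0; for n >= 3 they are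
pairwise distinct, hence orthonormal, and the variance is n/16.  For n = 2 both
products equal - s_1, so their sum squares to 4; for n = 1 the only product
is 1.

Expectations are turned into averages over all coin outcomes by
[expectation_fair_coins]; the vanishing of the averages of characters is the
sign reversal under flipping one well-chosen coin ([sum_odd0]). *)

(** * Averaging over fair coins *)

Section FairCoins.
Context (R : realType) (d : measure_display) (T : measurableType d)
  (P : probability T R) (I : finType) (eps : I -> {RV P >-> bool}).
Hypothesis eps_bernoulli : forall i : I,
  distribution P (eps i) =1 bernoulli_prob (2^-1 : R).
Hypothesis eps_indep : mutually_independent eps.

Lemma fair_coin_prob (i : I) (b : bool) :
  P (eps i @^-1` [set b])%classic = (2^-1)%:E.
Proof.
have := eps_bernoulli i [set b]%classic.
rewrite /distribution /pushforward => ->.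
rewrite /bernoulli_prob ifT; last by apply/andP; split; lra.
rewrite fsbig_set1 /bernoulli_pmf; case: b => //; congr EFin; lra.
Qed.

Let outcome (e : {ffun I -> bool}) : set T :=
  (\bigcap_(i in [set` [set: I]%SET]) (eps i @^-1` [set e i]))%classic.

Lemma outcomeE (e : {ffun I -> bool}) (w : T) :
  (w \in outcome e) = (e == [ffun i => eps i w]).
Proof.
apply/idP/eqP => [|->]; rewrite inE /outcome /=.
  by move=> we; apply/ffunP => i; rewrite ffunE -(we i)//= in_setT.
by move=> i _ /=; rewrite ffunE.
Qed.

Lemma measurable_outcome (e : {ffun I -> bool}) : measurable (outcome e).
Proof.
apply: fin_bigcap_measurable => [|i _]; first exact: finite_finset.
by rewrite -[X in measurable X]setTI; exact: measurable_funP.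
Qed.

Lemma outcome_prob (e : {ffun I -> bool}) :
  P (outcome e) = ((2^-1) ^+ #|I|)%:E.
Proof.
rewrite /outcome (@eps_indep [set: I]%SET (fun i => [set e i]%classic))//.
under eq_bigr do rewrite fair_coin_prob.
by rewrite prodEFin big_const iter_mulr_1 cardsT.
Qed.

(** The events [outcome e] partition the space into cells of equal probability,
and the random variable is constant on each of them. *)
Lemma expectation_fair_coins (f : {ffun I -> bool} -> R) :
  'E_P[fun w => f [ffun i => eps i w]]%E =
  ((2^-1) ^+ #|I| * \sum_(e : {ffun I -> bool}) f e)%:E.
Proof.
rewrite unlock.
transitivity (\int[P]_w \sum_(e : {ffun I -> bool})
                ((f e)%:E * (\1_(outcome e) w)%:E))%E.
  apply: eq_integral => w _.
  rewrite (bigD1 [ffun i => eps i w])//= indicE outcomeE eqxx mule1.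
  rewrite big1 ?adde0//.
  by move=> e /negPf ne; rewrite indicE outcomeE ne mule0.
have int1 e : P.-integrable setT (EFin \o \1_(outcome e) : T -> \bar R).
  exact/integrable_indic/measurable_outcome.
rewrite integral_sum//; last first.
  by move=> e; apply: integrableZl => //; exact: int1.
rewrite mulr_sumr -sumEFin; apply: eq_bigr => e _.
rewrite integralZl//; last exact: int1.
transitivity ((f e)%:E * P (outcome e))%E.
  congr (_ * _)%E; rewrite integral_indic ?setIT //.
  exact: measurable_outcome.
by rewrite outcome_prob -EFinM mulrC.
Qed.

End FairCoins.

(** * Counting the correct guesses *)

Section Game.
Local Open Scope nat_scope.

Lemma iota1S j : iota 1 j.+1 = rcons (iota 1 j) j.+1.
Proof. by rewrite -[in LHS](addn1 j) iotaD cats1. Qed.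

Lemma max_remaining n (c : nat) (shown deck : seq nat) :
  perm_eq (shown ++ c :: deck) (iota 1 n) -> sorted gtn (c :: deck) ->
  \max_(k <- iota 1 n | k \notin shown) k = c.
Proof.
move=> pe srt.
have un : uniq (shown ++ c :: deck) by rewrite (perm_uniq pe) iota_uniq.
rewrite -(perm_big _ pe) big_cat /= [X in maxn X]big_seq_cond.
rewrite big_pred0 ?max0n; last first.
  by move=> k; case: (k \in shown).
have -> : \max_(k <- c :: deck | k \notin shown) k = \max_(k <- c :: deck) k.
  rewrite big_seq_cond [RHS]big_seq_cond; apply: eq_bigl => k; rewrite andbT.
  case kd: (k \in c :: deck) => //=.
  by move: un; rewrite cat_uniq => /and3P[_ /hasPn/(_ k kd)/= -> _].
rewrite big_cons; apply/maxn_idPl; apply/bigmax_leqP_seq => k kd _.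
have gtn_trans : transitive gtn.
  by move=> x y z /= xy yz; exact: ltn_trans yz xy.
by move: srt; rewrite /= path_sortedE // => /andP[/allP/(_ k kd)/ltnW].
Qed.

(** After card n or n-1 the strategy names the largest remaining card, which is
the top one as soon as the rest of the deck is decreasing. *)
Lemma correct_guesses_decreasing n (shown deck : seq nat) :
  (n \in shown) || (n.-1 \in shown) ->
  perm_eq (shown ++ deck) (iota 1 n) -> sorted gtn deck ->
  correct_guesses_from (optimal_strategy n) shown deck = size deck.
Proof.
elim: deck shown => //= c deck IH shown special pe srt.
rewrite {1}/optimal_strategy special (max_remaining pe srt) eqxx add1n.
congr _.+1; apply: IH.
- by rewrite !mem_rcons !inE; case/orP: special => ->; rewrite !orbT.
- by rewrite cat_rcons.
- exact: path_sorted srt.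
Qed.

Section Deck.
Variables (b : pred nat) (m : nat).
Hypothesis b0 : b 0.

Let shown j := [seq c <- iota 1 j | b c].
Let down := rev [seq c <- iota 1 m | ~~ b c].

Lemma sorted_down : sorted gtn (m.+1 :: down).
Proof.
rewrite -rev_rcons rev_sorted.
apply: (subseq_sorted ltn_trans) (iota_ltn_sorted 1 m.+1).
by rewrite iota1S -!cats1 cat_subseq// filter_subseq.
Qed.

Lemma perm_deck : perm_eq (shown m ++ m.+1 :: down) (iota 1 m.+1).
Proof.
rewrite perm_sym iota1S perm_rcons perm_sym -[_ :: down]cat1s perm_catCA /=.
rewrite perm_cons.
rewrite -(permPr (permEl (perm_filterC b (iota 1 m)))) perm_cat2l.
by rewrite (permPl (permEl (perm_rev _))).
Qed.

(** What a player who knows only the last card learns about card j; the default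
0 of [last] and the convention [b 0] make this hold for j = 0 too. *)
Lemma last_shown j : (last 0 (shown j) == j) = b j.
Proof.
case: j => [|j]; first by rewrite b0.
rewrite /shown iota1S filter_rcons.
case: ifP => bj; first by rewrite last_rcons eqxx.
apply: contraFF bj => /eqP lj; have := mem_last 0 (shown j).
by rewrite lj inE /= mem_filter => /andP[].
Qed.

Lemma guess_rising j : j < m ->
  optimal_strategy m.+1 (shown j) = (last 0 (shown j)).+1.
Proof.
move=> jm; rewrite /optimal_strategy ifF // !mem_filter !mem_iota /=; lia.
Qed.

(** The two branches of the strategy agree on card m.+1: if m has been shown,
the largest remaining card is m.+1; otherwise the guess is the successor of the
last card shown, which is m.+1 only if m = 0. *)
Lemma correct_guess_top :
  (optimal_strategy m.+1 (shown m) == m.+1) = b m.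
Proof.
rewrite /optimal_strategy; case: ifPn => [|_]; last by rewrite eqSS last_shown.
rewrite !mem_filter !mem_iota /= => sp.
rewrite (max_remaining perm_deck sorted_down) eqxx; lia.
Qed.

(** Induction on the number k of labels between the current one and the turning
point m.+1.  The invariant is that the cards shown are the rising ones with
label at most j. *)
Lemma correct_guesses_rising j k : j + k = m ->
  correct_guesses_from (optimal_strategy m.+1) (shown j)
    ([seq c <- iota j.+1 k | b c] ++ m.+1 :: down) =
  \sum_(j <= c < m) (b c && b c.+1) + b m + size down.
Proof.
elim: k j => [|k IH] j; rewrite ?addn0 ?addnS => jm.
  rewrite jm big_geq //= correct_guess_top add0n; congr (_ + _).
  apply: correct_guesses_decreasing.
  - by rewrite mem_rcons inE eqxx.
  - by rewrite cat_rcons perm_deck.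
  - exact: path_sorted sorted_down.
have lt_jm : j < m by lia.
have shownS : shown j.+1 = if b j.+1 then rcons (shown j) j.+1 else shown j.
  by rewrite /shown iota1S filter_rcons.
rewrite big_ltn //= -(addnA (b j && b j.+1)) -(addnA (b j && b j.+1)).
rewrite -(IH j.+1) ?addSn // shownS.
case: (b j.+1); last by rewrite andbF add0n.
by rewrite /= guess_rising // eqSS last_shown andbT.
Qed.

Lemma correct_guesses_deck : b m.+1 ->
  correct_guesses (optimal_strategy m.+1) (shown m ++ m.+1 :: down) =
  \sum_(c < m.+1) ((b c && b c.+1) + ~~ b c.+1).
Proof.
move=> bm; rewrite /correct_guesses (correct_guesses_rising (add0n m)).
rewrite -(big_mkord xpredT (fun c => (b c && b c.+1) + ~~ b c.+1)).
rewrite big_nat_recr //= bm andbT addn0 big_split /= addnAC; congr (_ + _ + _).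
rewrite size_rev size_filter -sum1_count big_mkcond /index_iota subn0 /=.
rewrite (iotaDl 1 0 m) big_map; apply: eq_bigr => c _.
by rewrite add1n; case: (b _).
Qed.

End Deck.

(** Card 0 and the card m.+1 at the turning point count as rising, so that the
boundary terms of the count need no separate treatment. *)
Definition rising m (e : 'I_m.+1 -> bool) (c : nat) : bool :=
  (0 < c <= m) ==> e (inord c.-1).

Lemma shelf_shuffle_deck m (e : 'I_m.+1 -> bool) :
  shelf_shuffle e = [seq c <- iota 1 m | rising e c] ++
    m.+1 :: rev [seq c <- iota 1 m | ~~ rising e c].
Proof.
pose e0 c := e (inord c.-1).
have labels a : [seq (val i).+1 | i : 'I_m.+1 <- enum 'I_m.+1 & a (e i)] =
    [seq c <- iota 1 m.+1 | a (e0 c)].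
  rewrite -[1%N]addn0 iotaDl -val_enum_ord -map_comp filter_map; congr map.
  by apply: eq_filter => i /=; rewrite /e0 /= inord_val.
have risingE a : [seq c <- iota 1 m | a (rising e c)] =
    [seq c <- iota 1 m | a (e0 c)].
  apply: eq_in_filter => c; rewrite mem_iota /rising => cm.
  by have -> : 0 < c <= m by lia.
rewrite shelf_shuffleE (labels id) (labels negb) (risingE id) (risingE negb).
rewrite iota1S !filter_rcons; case: (e0 m.+1) => /=; first by rewrite cat_rcons.
by rewrite rev_rcons.
Qed.

Lemma correct_guesses_shuffle m (e : 'I_m.+1 -> bool) :
  correct_guesses (optimal_strategy m.+1) (shelf_shuffle e) =
  \sum_(c < m.+1) ((rising e c && rising e c.+1) + ~~ rising e c.+1).
Proof.
by rewrite shelf_shuffle_deck correct_guesses_deck // /rising ltnn andbF.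
Qed.

End Game.

(** * Orthogonality of the edge characters *)

Section Walsh.
Variables (R : realType) (m : nat).
Implicit Types (e : {ffun 'I_m.+1 -> bool}) (i j : 'I_m.+1).

Definition spin e (c : nat) : R := (-1) ^+ rising e c.

(** The Walsh character of the pair of adjacent cards c and c+1; for m > 0, the
edges 0 and m are minus a single spin. *)
Definition edge e (c : nat) : R := spin e c * spin e c.+1.

Definition flip_coin (k : nat) e : {ffun 'I_m.+1 -> bool} :=
  [ffun i => e i (+) (i.+1 == k)].

Lemma flip_coinK k : involutive (flip_coin k).
Proof. by move=> e; apply/ffunP => i; rewrite !ffunE addbK. Qed.

Lemma spin_flip k e c : (0 < k <= m)%N ->
  spin (flip_coin k e) c = (-1) ^+ (c == k) * spin e c.
Proof.
move=> km; rewrite /spin -signr_addb /rising; congr (_ ^+ nat_of_bool _).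
case: (boolP (0 < c <= m)%N) => cm /=.
  by rewrite ffunE inordK 1?addbC; [case: c cm|lia].
by case: eqP => // ck; rewrite ck km in cm.
Qed.

Lemma edge_flip k e c : (0 < k <= m)%N ->
  edge (flip_coin k e) c = (-1) ^+ ((c == k) (+) (c.+1 == k)) * edge e c.
Proof. by move=> km; rewrite /edge !spin_flip // signr_addb mulrACA. Qed.

(** Flipping a coin permutes the outcomes, so the sum equals its opposite. *)
Lemma sum_odd0 k (f : {ffun 'I_m.+1 -> bool} -> R) :
  (forall e, f (flip_coin k e) = - f e) -> \sum_e f e = 0.
Proof.
move=> fN; have : \sum_e f e = - \sum_e f e.
  rewrite -sumrN (reindex_inj (inv_inj (flip_coinK k))) /=.
  by apply: eq_bigr => e _; exact: fN.
lra.
Qed.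

Lemma edge_sqr e c : edge e c ^+ 2 = 1.
Proof. by rewrite /edge /spin exprMn !sqrr_sign mulr1. Qed.

(** Each edge has an endpoint in 1..m as soon as m > 0, and the coin there
reverses its sign; edge 0 has only the endpoint 1. *)
Lemma sum_edge i : (0 < m)%N -> \sum_e edge e i = 0.
Proof.
move=> m0; apply: (@sum_odd0 (maxn i 1)) => e.
have im := ltn_ord i.
rewrite edge_flip; last lia.
have -> : (i == maxn i 1 :> nat) (+) (i.+1 == maxn i 1) = true by lia.
by rewrite expr1 mulN1r.
Qed.

(** Once 0 and m.+1 are identified, the edges form a cycle on m.+1 vertices, and
two distinct edges of a cycle on at least three vertices differ in at least two
endpoints.  One of these is not the vertex 0 = m.+1 of constant spin, and
flipping its coin reverses the sign of the product of the two edges. *)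
Lemma sum_edgeM i j : (1 < m)%N -> i != j -> \sum_e edge e i * edge e j = 0.
Proof.
move=> m1; wlog ij : i j / (i < j)%N => [wl|_].
  move=> ne; have [ij|ji|/val_inj ij] := ltngtP i j; first exact: wl.
    by under eq_bigr do rewrite mulrC; apply: wl => //; rewrite eq_sym.
  by rewrite ij eqxx in ne.
have jm := ltn_ord j.
(* If j < m, the upper endpoint of edge j is a coin outside edge i.  If j = m,
   edge j is {m, m+1}: the lower endpoint of edge i is outside it, or, for
   i = 0, the upper endpoint 1, since m > 1. *)
pose k := if (j < m)%N then j.+1 else if (0 < i)%N then i : nat else 1%N.
apply: (@sum_odd0 k) => e.
rewrite !edge_flip; [|rewrite /k; do 2?case: ifP; lia..].
rewrite mulrACA -signr_addb.
have -> : ((i ==  k :> nat) (+) (i.+1 == k)) (+)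
    ((j == k :> nat) (+) (j.+1 == k)) = true.
  rewrite /k; do 2?case: ifP; lia.
by rewrite expr1 mulN1r.
Qed.

Lemma card_outcomes : \sum_(e : {ffun 'I_m.+1 -> bool}) (1 : R) = 2 ^+ m.+1.
Proof. by rewrite sumr_const card_ffun card_bool card_ord natrX. Qed.

Lemma sum_sqr_edges : (1 < m)%N ->
  \sum_e (\sum_(i < m.+1) edge e i) ^+ 2 = m.+1%:R * 2 ^+ m.+1.
Proof.
move=> m1.
transitivity (\sum_(i < m.+1) \sum_(j < m.+1) \sum_e edge e i * edge e j).
  under eq_bigr do rewrite expr2 mulr_suml.
  rewrite exchange_big; apply: eq_bigr => i _.
  by under eq_bigr do rewrite mulr_sumr; rewrite exchange_big.
rewrite (eq_bigr (fun=> 2 ^+ m.+1)) => [|i _].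
  by rewrite sumr_const card_ord -[LHS]mulr_natl.
rewrite (bigD1 i) //= [X in _ + X]big1 => [|j ij]; last first.
  by rewrite sum_edgeM // eq_sym.
by rewrite addr0 -card_outcomes; apply: eq_bigr => e _; rewrite -expr2 edge_sqr.
Qed.

(** The linear terms telescope because both ends have spin -1. *)
Lemma sum_correct e :
  \sum_(c < m.+1) (((rising e c && rising e c.+1) + ~~ rising e c.+1)%:R : R) =
  3 * m.+1%:R / 4 + (\sum_(i < m.+1) edge e i) / 4.
Proof.
rewrite (eq_bigr (fun c : 'I_m.+1 =>
  3 / 4 + (spin e c.+1 - spin e c) / 4 + edge e c / 4)); last first.
  move=> c _; rewrite /edge /spin.
  by case: (rising e c); case: (rising e c.+1); rewrite /= ?expr1 ?expr0; lra.
rewrite !big_split /= -!mulr_suml sumr_const card_ord.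
rewrite -(big_mkord xpredT (fun c => spin e c.+1 - spin e c)) telescope_sumr //.
rewrite /spin /rising ltnn andbF /= subrr mul0r addr0 -mulr_natr.
by congr (_ + _); ring.
Qed.

Lemma correct_guesses_edges e :
  (correct_guesses (optimal_strategy m.+1) (shelf_shuffle e))%:R =
  3 * m.+1%:R / 4 + (\sum_(i < m.+1) edge e i) / 4.
Proof. by rewrite correct_guesses_shuffle natr_sum sum_correct. Qed.

Lemma sum_edges_1card e : m = 0%N -> \sum_(i < m.+1) edge e i = 1.
Proof.
move=> m0; rewrite /edge /spin; move: e; rewrite m0 => e.
by rewrite big_ord1 /rising /= mulrNN mulr1.
Qed.

Lemma sqr_sum_edges_2cards e : m = 1%N -> (\sum_(i < m.+1) edge e i) ^+ 2 = 4.
Proof.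
move=> m1; rewrite /edge /spin; move: e; rewrite m1 => e.
rewrite !big_ord_recl big_ord0 /= /rising /=.
by case: (e _); rewrite /= ?expr1 ?expr0; lra.
Qed.

Definition average (f : {ffun 'I_m.+1 -> bool} -> R) : R :=
  2^-1 ^+ m.+1 * \sum_e f e.

Lemma average_cst a : average (fun=> a) = a.
Proof.
rewrite /average sumr_const card_ffun card_bool card_ord -[a *+ _]mulr_natl.
by rewrite natrX mulrA -exprMn mulVf // expr1n mul1r.
Qed.

Lemma eq_average f g : f =1 g -> average f = average g.
Proof. by move=> fg; congr (_ * _); apply: eq_bigr => e _; exact: fg. Qed.

Lemma average_affine a b f : average (fun e => a + f e * b) = a + average f * b.
Proof.
rewrite -[in RHS](average_cst a) /average big_split /= mulrDr.
by rewrite -mulr_suml mulrA.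
Qed.

Lemma average_sum_edges : (0 < m)%N ->
  average (fun e => \sum_(i < m.+1) edge e i) = 0.
Proof.
move=> m0; rewrite /average exchange_big big1 ?mulr0 // => i _.
exact: sum_edge.
Qed.

Lemma average_sqr_sum_edges : (1 < m)%N ->
  average (fun e => (\sum_(i < m.+1) edge e i) ^+ 2) = m.+1%:R.
Proof.
move=> m1; rewrite /average sum_sqr_edges // mulrCA -exprMn mulVf //.
by rewrite expr1n mulr1.
Qed.

End Walsh.

(** * Mean and variance *)

Theorem corollary1 (R : realType) (d : measure_display) (T : measurableType d)
    (P : probability T R) (n : nat) (n_gt0 : (0 < n)%N)
    (eps : 'I_n -> {RV P >-> bool})
    (eps_bernoulli : forall i : 'I_n,
       distribution P (eps i) =1 bernoulli_prob (2^-1 : R))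
    (eps_indep : mutually_independent eps) :
  ('E_P[num_correct R eps] =
     (if n == 1%N then 1 else 3 * n%:R / 4)%:E)%E /\
  ('V_P[num_correct R eps] =
     (if n == 1%N then 0 else if n == 2%N then 1 / 4 else n%:R / 16)%:E)%E.
Proof.
case: n n_gt0 eps eps_bernoulli eps_indep => // m _.
move=> eps eps_bernoulli eps_indep.
pose N (e : {ffun 'I_m.+1 -> bool}) : R :=
  (correct_guesses (optimal_strategy m.+1) (shelf_shuffle e))%:R.
pose S (e : {ffun 'I_m.+1 -> bool}) : R := \sum_(i < m.+1) edge R e i.
have NE e : N e = 3 * m.+1%:R / 4 + S e / 4 := correct_guesses_edges R e.
have XE : num_correct R eps = fun w => N [ffun i => eps i w].
  apply/funext => w; rewrite /num_correct /N; congr (correct_guesses _ _)%:R.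
  by congr (shelf_shuffle _); apply/funext => i; rewrite ffunE.
have E_average (f : {ffun 'I_m.+1 -> bool} -> R) :
    'E_P[fun w => f [ffun i => eps i w]]%E = (average f)%:E.
  by rewrite expectation_fair_coins // card_ord.
set mu : R := if m.+1 == 1%N then 1 else _.
have meanN : average N = mu.
  rewrite /mu eqSS; have [m0|m_gt0] := posnP m.
    rewrite (eq_average (g := fun=> 1)) ?average_cst // => e.
    by rewrite NE /S sum_edges_1card // m0; lra.
  have S0 : average S = 0 := average_sum_edges R m_gt0.
  by rewrite (eq_average NE) average_affine S0 mul0r addr0.
have meanX : 'E_P[num_correct R eps]%E = mu%:E by rewrite XE E_average meanN.
split=> //; rewrite /variance unlock meanX /=.
transitivity (average (fun e => (N e - mu) ^+ 2))%:E.
  by rewrite -E_average XE; congr expectation.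
congr EFin; rewrite /mu !eqSS; have [m0|m_gt0] := posnP m.
  rewrite (eq_average (g := fun=> 0)) ?average_cst // => e.
  by rewrite NE /S sum_edges_1card // m0; lra.
have centred e : (N e - 3 * m.+1%:R / 4) ^+ 2 = 0 + S e ^+ 2 / 16.
  by rewrite NE; field.
rewrite (eq_average centred); have [m1|m_neq1] := eqVneq m 1%N.
  rewrite (eq_average (g := fun=> 1 / 4)) ?average_cst // => e.
  by rewrite /S sqr_sum_edges_2cards //; lra.
have m_gt1 : (1 < m)%N by rewrite ltn_neqAle eq_sym m_neq1.
have S2 : average (fun e => S e ^+ 2) = m.+1%:R.
  exact: average_sqr_sum_edges.
by rewrite average_affine S2 add0r.
Qed.
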